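(* Let $(\mathcal U,U,V)$ be a CR metric $f$-structure. Let $\mathscr M$ be a $V$-normed $U$-module and let $\mathscr N\subsetneq\mathscr M$ be a $V$-normed $U$-submodule of $\mathscr M$. Let $f\colon\mathscr N\to V$ be a $U$-linear map and $p\colon\mathscr M\to V^+$ a $U$-sublinear map with $f\le p$ on $\mathscr N$. Then there exists a $U$-linear map $\bar f\colon\mathscr M\to V$ such that $\bar f|_{\mathscr N}=f$ and $\bar f\le p$ on $\mathscr M$.
   Context: Riesz spaces and $f$-algebras. $\mathbb R^+=[0,\infty)$. A Riesz space is a real vector space $U$ with a partial order that is a lattice and satisfies $u\le v\Rightarrow u+w\le v+w$ and ($u\ge 0$, $\lambda\in\mathbb R^+$) $\Rightarrow\lambda u\ge 0$; $\vee,\wedge$ denote sup and inf of two elements, $u^{+}=u\vee 0$, $u^-=(-u)\vee 0$, $|u|=u\vee(-u)$, $U^+=\{u\in U:u\ge 0\}$. A Riesz subspace is a linear subspace closed under $\vee,\wedge$; a Riesz subspace $V\subset U$ is solid if $v\in U$, $u\in V$, $|v|\le|u|$ imply $v\in V$. A family is disjoint if $|u|\wedge|v|=0$ for any two different members. Dedekind complete (resp. $\sigma$-complete): every non-empty (resp. countable non-empty) subset bounded above has a supremum and every such subset bounded below has an infimum. A Dedekind complete partially ordered set $P$ is countably representable (CR) if every non-empty $S\subset P$ bounded above contains a sequence $(s_n)_n\subset S$ with $\sup_ns_n=\sup S$ and every non-empty $S\subset P$ bounded below contains a sequence $(s_n)_n\subset S$ with $\inf_ns_n=\inf S$. An $f$-algebra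 is a Riesz space with an associative, commutative, $\mathbb R$-bilinear multiplication with unit $\mathbf 1_U$ such that $uv\ge0$ for $u,v\ge 0$, and $(uw)\wedge v=0$ whenever $u\wedge v=0$ and $w\ge 0$. An $f$-subalgebra is a Riesz subspace closed under multiplication and containing $\mathbf 1_U$. $\mathrm{Idem}(U)=\{u\in U:u^2=u\}$. A finite partition of $u\in\mathrm{Idem}(U)$ is a finite disjoint family in $\mathrm{Idem}(U)$ with sum $u$; a countable partition of $u$ is a disjoint family $(u_n)_{n\in\mathbb N}\subset\mathrm{Idem}(U)$ with $\sup_n u_n=u$; $\mathcal P(u)$ is the set of countable partitions of $u$. Simple elements: $\mathcal S(U)=\{\sum_{i=1}^n\lambda_iu_i:\lambda_i\in\mathbb R,\ (u_i)_{i=1}^n\text{ a finite partition of }\mathbf 1_U\}$. An order-preserving map is $\sigma$-order-continuous if it preserves existing suprema of non-decreasing sequences and existing infima of non-increasing sequences. A localisable $f$-algebra is a Dedekind $\sigma$-complete $f$-algebra whose multiplication is $\sigma$-order-continuous on $U^+\times U^+$ and such that every $u\in U^+$ is the supremum of a non-decreasing sequence in $\mathcal S(U)\cap U^+$. Metric notions (products of metric spaces carry the sum distance). A metric Riesz space $(U,\mathsf d_U)$ is a Dedekind $\sigma$-complete Riesz space with a complete distance such that $\mathsf d_U(u,0)=\mathsf d_U(|u|,0)$, $\mathsf d_U(u+w,v+w)=\mathsf d_U(u,v)$, and $\mathsf d_U(u,0)\le\mathsf d_U(v,0)$ whenever $0\le u\le v$. A metric $f$-algebra is a localisable $f$-algebra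 $U$ with a distance $\mathsf d_U$ such that $(U,\mathsf d_U)$ is a metric Riesz space, the multiplication $U\times U\to U$ is continuous, $\mathcal S(U)$ is dense, and $\mathsf d_U(\varepsilon\mathbf 1_U,0)\to0$ as $\varepsilon\searrow0$. A metric $f$-structure is a triple $(\mathcal U,U,V)$ where $\mathcal U$ is a localisable $f$-algebra; $(U,\mathsf d_U)$ is a metric $f$-algebra that is a solid $f$-subalgebra of $\mathcal U$; $(V,\mathsf d_V)$ is a metric Riesz space that is a solid Riesz subspace of $\mathcal U$; $UV=V$ (where $UV=\{uv:u\in U,v\in V\}$) and the multiplication $U\times V\to V$ is continuous; and for any $(u_n)_n\in\mathcal P(\mathbf 1_U)$ and $\varepsilon>0$ there is $\delta>0$ such that, whenever $(v_n)_n\subset V^+$ satisfies $\sum_n\mathsf d_V(u_nv_n,0)\le\delta$, the family $(u_nv_n)_n$ is order-bounded in $V$ and $\mathsf d_V(\sup_nu_nv_n,0)\le\varepsilon$. It is CR if $\mathcal U$, $U$ and $V$ are CR. Modules. A $V$-normed $U$-module is a $U$-module $\mathscr M$ (a real vector space via $\lambda v=(\lambda\mathbf 1_U)\cdot v$) with a map $|\cdot|\colon\mathscr M\to V^+$ such that $|v|=0\iff v=0$, $|v+w|\le|v|+|w|$, $|u\cdot v|=|u||v|$, and the glueing property holds: if $(u_n)_n\in\mathcal P(\mathbf 1_U)$ and $(v_n)_n\subset\mathscr M$ are such that $(|u_n\cdot v_n|)_n$ is order-bounded in $V$ (one writes $(u_n,v_n)_n\in\mathrm{Adm}(\mathscr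 M)$), then there is a (necessarily unique) $v\in\mathscr M$ with $u_n\cdot v=u_n\cdot v_n$ for all $n$, denoted $\sum_{n\in\mathbb N}u_n\cdot v_n$. For $\varnothing\ne S\subset\mathscr M$, $\mathscr G(S)=\{\sum_nu_n\cdot v_n:(u_n)_n\in\mathcal P(\mathbf 1_U),(v_n)_n\subset S,(u_n,v_n)_n\in\mathrm{Adm}(\mathscr M)\}$. A $V$-normed $U$-submodule of $\mathscr M$ is a $U$-submodule $\mathscr N$ with $\mathscr G(\mathscr N)=\mathscr N$. $V$ is a $U$-module via the multiplication of $\mathcal U$. A map $p\colon\mathscr M\to V^+$ is $U$-sublinear if $p(v+w)\le p(v)+p(w)$ for all $v,w\in\mathscr M$ and $p(u\cdot v)=u\,p(v)$ for all $u\in U^+$, $v\in\mathscr M$. *)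

(* Defs.v *)
From HB Require Import structures.
From mathcomp Require Import all_boot all_order all_algebra.
From mathcomp Require Import all_classical all_reals all_analysis.

Set Implicit Arguments.
Unset Strict Implicit.
Unset Printing Implicit Defensive.

Import Order.TTheory GRing.Theory Num.Theory.
Import numFieldNormedType.Exports.

Local Open Scope classical_set_scope.
Local Open Scope ring_scope.

Section OrderCompleteness.
Context d (T : porderType d).
Implicit Types (S D : set T).

Definition dedekind_complete :=
  (forall S, S !=set0 -> has_ubound S -> supremums S !=set0) /\
  (forall S, S !=set0 -> has_lbound S -> infimums S !=set0).

Definition dedekind_sigma_complete :=
  (forall S, countable S -> S !=set0 -> has_ubound S ->
     supremums S !=set0) /\
  (forall S, countable S -> S !=set0 -> has_lbound S ->
     infimums S !=set0).

(* [supremums S] and [infimums S] are the (at most one-element) sets of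
   suprema and infima, hence the equalities between sets. *)
Definition countably_representable :=
  [/\ dedekind_complete,
      forall S, S !=set0 -> has_ubound S ->
        exists s : nat -> T,
          (forall n, S (s n)) /\ supremums (range s) = supremums S &
      forall S, S !=set0 -> has_lbound S ->
        exists s : nat -> T,
          (forall n, S (s n)) /\ infimums (range s) = infimums S].

(* Suprema and infima computed in the subset D with the induced order. *)
Definition sup_in D S : set T :=
  [set x | [/\ D x, ubound S x & lbound (D `&` ubound S) x]].
Definition inf_in D S : set T :=
  [set x | [/\ D x, lbound S x & ubound (D `&` lbound S) x]].

End OrderCompleteness.

Arguments dedekind_complete {d} T.
Arguments dedekind_sigma_complete {d} T.
Arguments countably_representable {d} T.

(* The restriction of f to D is sigma-order-continuous. *)
Definition sigma_order_continuous_on d d' (T : porderType d)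
    (T' : porderType d') (D : set T) (f : T -> T') :=
  [/\ forall x y, D x -> D y -> (x <= y)%O -> (f x <= f y)%O,
      forall (s : nat -> T) x, (forall n, D (s n)) -> nondecreasing_seq s ->
        sup_in D (range s) x -> supremums (range (f \o s)) (f x) &
      forall (s : nat -> T) x, (forall n, D (s n)) -> nonincreasing_seq s ->
        inf_in D (range s) x -> infimums (range (f \o s)) (f x)].

Reserved Notation "u '≼' v" (at level 70, no associativity).

(* The order is not an [Order.Lattice] on the carrier: Hierarchy Builder has no
   join of that structure with [GRing.Lmodule]. It is one on the convertible
   copy [ordered U] below, to which the order-theoretic notions are applied. *)
HB.mixin Record isRiesz (R : realType) U & GRing.Lmodule R U := {
  rle : rel U ;
  rjoin : U -> U -> U ;
  rmeet : U -> U -> U ;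
  rle_refl : reflexive rle ;
  rle_anti : antisymmetric rle ;
  rle_trans : transitive rle ;
  rle_meet : forall u v w, rle u (rmeet v w) = rle u v && rle u w ;
  rjoin_le : forall u v w, rle (rjoin u v) w = rle u w && rle v w ;
  rleD2r : forall u v w, rle u v -> rle (u + w) (v + w) ;
  rscale_ge0 : forall (a : R) u, 0 <= a -> rle 0 u -> rle 0 (a *: u)
}.

#[short(type="rieszType")]
HB.structure Definition Riesz (R : realType) :=
  {U of GRing.Lmodule R U & isRiesz R U}.

Notation "u '≼' v" := (rle u v) : ring_scope.

Definition ordered (R : realType) (U : rieszType R) : Type := U.
HB.instance Definition _ (R : realType) (U : rieszType R) :=
  Choice.on (ordered U).
HB.instance Definition _ (R : realType) (U : rieszType R) :=
  Order.Le_isPOrder.Build ring_display (ordered U)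
    (@rle_refl R U) (@rle_anti R U) (@rle_trans R U).
HB.instance Definition _ (R : realType) (U : rieszType R) :=
  Order.POrder_MeetJoin_isLattice.Build ring_display (ordered U)
    (@rle_meet R U) (@rjoin_le R U).

Section RieszDefs.
Context (R : realType) (U : rieszType R).

Definition is_sup (S : set U) (x : U) := supremums (S : set (ordered U)) x.

Definition order_bounded (S : set U) :=
  has_ubound (S : set (ordered U)) /\ has_lbound (S : set (ordered U)).

Definition rabs (u : U) : U := rjoin u (- u).

Definition disjoint_family (I : eqType) (u : I -> U) :=
  forall i j, i != j -> rmeet (rabs (u i)) (rabs (u j)) = 0.

Definition solid (A : set U) := forall u v, A u -> rabs v ≼ rabs u -> A v.

End RieszDefs.

(* [comAlgType R] only excludes the zero algebra, over which every unital
   module is zero. *)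
HB.mixin Record isFAlgebra (R : realType) U
    & GRing.ComAlgebra R U & Riesz R U := {
  falg_mul_ge0 : forall u v : U, 0 ≼ u -> 0 ≼ v -> 0 ≼ u * v ;
  falg_meet_mul : forall u v w : U,
    rmeet u v = 0 -> 0 ≼ w -> rmeet (u * w) v = 0
}.

#[short(type="fAlgType")]
HB.structure Definition FAlgebra (R : realType) :=
  {U of GRing.ComAlgebra R U & Riesz R U & isFAlgebra R U}.

Section FAlgebraDefs.
Context (R : realType) (U : fAlgType R).

Definition idem : set U := [set u | u ^+ 2 = u].

Definition finite_partition n (u : U) (e : 'I_n -> U) :=
  [/\ forall i, idem (e i), disjoint_family e & \sum_(i < n) e i = u].

Definition countable_partition (u : U) (e : nat -> U) :=
  [/\ forall n, idem (e n), disjoint_family e & is_sup (range e) u].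

Definition simple : set U :=
  [set x | exists n (a : 'I_n -> R) (e : 'I_n -> U),
     finite_partition 1 e /\ x = \sum_(i < n) a i *: e i].

End FAlgebraDefs.

Arguments simple {R} U.

HB.mixin Record isLocalisable (R : realType) U & FAlgebra R U := {
  localisable_sigma_complete : dedekind_sigma_complete (ordered U) ;
  localisable_mul_continuous :
    sigma_order_continuous_on (T := (ordered U *p ordered U)%type)
      (T' := ordered U)
      [set z : U * U | 0 ≼ z.1 /\ 0 ≼ z.2] (fun z : U * U => z.1 * z.2) ;
  localisable_simple_approx : forall u : U, 0 ≼ u ->
    exists s : nat -> U,
      [/\ forall n, simple U (s n) /\ 0 ≼ s n,
          forall m n, (m <= n)%N -> s m ≼ s n & is_sup (range s) u]
}.

#[short(type="localisableFAlgType")]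
HB.structure Definition LocalisableFAlgebra (R : realType) :=
  {U of FAlgebra R U & isLocalisable R U}.

HB.mixin Record hasDistance (R : realType) U := {
  rdist : U -> U -> R ;
  rdistxx : forall x, rdist x x = 0 ;
  rdist_positivity : forall x y, rdist x y = 0 -> x = y ;
  rdist_sym : forall x y, rdist x y = rdist y x ;
  rdist_triangle : forall y x z, rdist x z <= rdist x y + rdist y z
}.

#[short(type="distRieszType")]
HB.structure Definition DistRiesz (R : realType) :=
  {U of Riesz R U & hasDistance R U}.

(* As for the order, the library's topological structures live on a
   convertible copy of the carrier. *)
Definition metrized (R : realType) (U : distRieszType R) : Type := U.
HB.instance Definition _ (R : realType) (U : distRieszType R) :=
  Choice.on (metrized U).
HB.instance Definition _ (R : realType) (U : distRieszType R) :=
  isMetric.Build R (metrized U) (@rdistxx R U) (@rdist_positivity R U)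
    (@rdist_sym R U) (@rdist_triangle R U).

HB.mixin Record isMetricRiesz (R : realType) U & DistRiesz R U := {
  mriesz_sigma_complete : dedekind_sigma_complete (ordered U) ;
  mriesz_dist_complete : forall G : set_system (metrized U),
    ProperFilter G -> cauchy G -> exists l : metrized U, G --> l ;
  mriesz_dist_abs : forall u : U, rdist u 0 = rdist (rabs u) 0 ;
  mriesz_dist_transl : forall u v w : U, rdist (u + w) (v + w) = rdist u v ;
  mriesz_dist_mono : forall u v : U, 0 ≼ u -> u ≼ v -> rdist u 0 <= rdist v 0
}.

#[short(type="metricRieszType")]
HB.structure Definition MetricRiesz (R : realType) :=
  {U of DistRiesz R U & isMetricRiesz R U}.

HB.mixin Record isMetricFAlgebra (R : realType) U
    & LocalisableFAlgebra R U & MetricRiesz R U := {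
  mfalg_mul_continuous :
    continuous (fun z : metrized U * metrized U =>
      ((z.1 : U) * (z.2 : U) : metrized U)) ;
  mfalg_dense_simple : dense (simple U : set (metrized U)) ;
  mfalg_dist_unit :
    (fun e : R => rdist (e *: (1 : U)) 0) @ 0^'+ --> (0 : R)
}.

#[short(type="metricFAlgType")]
HB.structure Definition MetricFAlgebra (R : realType) :=
  {U of LocalisableFAlgebra R U & MetricRiesz R U & isMetricFAlgebra R U}.

(* The map i identifies U with a Riesz subspace (resp. an f-subalgebra) of W; being an
   injective lattice morphism, it also preserves and reflects the order. *)
Definition riesz_embedding (R : realType) (U W : rieszType R) (i : U -> W) :=
  [/\ injective i, linear i,
      forall u v, i (rjoin u v) = rjoin (i u) (i v) &
      forall u v, i (rmeet u v) = rmeet (i u) (i v)].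

Definition falg_embedding (R : realType) (U W : fAlgType R) (i : U -> W) :=
  [/\ riesz_embedding i, i 1 = 1 & forall u v, i (u * v) = i u * i v].

(* U and V are types of their own, identified with solid subspaces of
   [fs_ambient] through [fs_inU] and [fs_inV]. The map [fs_act] is the
   multiplication U x V -> V inherited from [fs_ambient]; it is determined by
   [fs_actE]. *)
Record metricFStructure (R : realType) := MetricFStructure {
  fs_ambient : localisableFAlgType R ;
  fs_U : metricFAlgType R ;
  fs_V : metricRieszType R ;
  fs_inU : fs_U -> fs_ambient ;
  fs_inV : fs_V -> fs_ambient ;
  fs_inU_embedding : falg_embedding fs_inU ;
  fs_inU_solid : solid (range fs_inU) ;
  fs_inV_embedding : riesz_embedding fs_inV ;
  fs_inV_solid : solid (range fs_inV) ;
  fs_mulUV : [set fs_inU u * fs_inV v | u in [set: fs_U] & v in [set: fs_V]]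
             = range fs_inV ;
  fs_act : fs_U -> fs_V -> fs_V ;
  fs_actE : forall u v, fs_inV (fs_act u v) = fs_inU u * fs_inV v ;
  fs_act_continuous :
    continuous (fun z : metrized fs_U * metrized fs_V =>
      (fs_act z.1 z.2 : metrized fs_V)) ;
  fs_glue_dist : forall (u : nat -> fs_U) (eps : R),
    countable_partition 1 u -> 0 < eps ->
    exists2 delta : R, 0 < delta &
      forall v : nat -> fs_V, (forall n, 0 ≼ v n) ->
        (\sum_(0 <= n <oo) (rdist (fs_act (u n) (v n)) 0)%:E <= delta%:E)%E ->
        order_bounded (range (fun n => fs_act (u n) (v n))) /\
        exists2 s, is_sup (range (fun n => fs_act (u n) (v n))) s &
                   rdist s 0 <= eps
}.

Definition fs_CR (R : realType) (F : metricFStructure R) :=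
  [/\ countably_representable (ordered (fs_ambient F)),
      countably_representable (ordered (fs_U F)) &
      countably_representable (ordered (fs_V F))].

(* Admissibility is expressed with the norm alone so that it can be used in
   the glueing axiom of normed modules. *)
Definition admissible (R : realType) (F : metricFStructure R)
    (M : lmodType (fs_U F)) (nrm : M -> fs_V F)
    (u : nat -> fs_U F) (v : nat -> M) :=
  countable_partition 1 u /\ order_bounded (range (fun n => nrm (u n *: v n))).

HB.mixin Record isVNormed (R : realType) (F : metricFStructure R) M
    & GRing.Lmodule (fs_U F) M := {
  vnorm : M -> fs_V F ;
  vnorm_ge0 : forall v, 0 ≼ vnorm v ;
  vnorm_eq0 : forall v, vnorm v = 0 <-> v = 0 ;
  vnormD : forall v w, vnorm (v + w) ≼ vnorm v + vnorm w ;
  vnormZ : forall (u : fs_U F) v, vnorm (u *: v) = fs_act (rabs u) (vnorm v) ;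
  vnorm_glueing : forall (u : nat -> fs_U F) (v : nat -> M),
    admissible vnorm u v -> exists w : M, forall n, u n *: w = u n *: v n
}.

#[short(type="vNormedModType")]
HB.structure Definition VNormedModule (R : realType)
    (F : metricFStructure R) :=
  {M of GRing.Lmodule (fs_U F) M & isVNormed R F M}.

Section NormedModuleDefs.
Context (R : realType) (F : metricFStructure R) (M : vNormedModType F).

Definition glueings (S : set M) : set M :=
  [set w | exists (u : nat -> fs_U F) (v : nat -> M),
     [/\ admissible vnorm u v, forall n, S (v n) &
         forall n, u n *: w = u n *: v n]].

Definition U_sublinear (p : M -> fs_V F) :=
  [/\ forall v, 0 ≼ p v,
      forall v w, p (v + w) ≼ p v + p w &
      forall (u : fs_U F) v, 0 ≼ u -> p (u *: v) = fs_act u (p v)].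

End NormedModuleDefs.

(* Main.v *)
From HB Require Import structures.
Require Import Defs.
From mathcomp Require Import all_boot all_order all_algebra.
From mathcomp Require Import all_classical all_reals all_analysis.
From mathcomp Require Import ring.

(** The proof follows the classical Hahn-Banach argument. By Zorn's lemma there is a maximal
    U-linear extension below [p] ([total_dominated_graph]), and it is everywhere defined as soon
    as one more point [x] can be adjoined to any domain ([extend_dominated]).

    As V is Dedekind complete, there is [w] in V with [v + w ≼ p (y + x)] and [v - w ≼ p (y - x)]
    for every [y] in the domain with value [v] ([separating_value]). Taking [w] as the value at [x]
    requires [v + u w ≼ p (y + u x)] for every [u] in U, whereas the choice of [w] only gives it for
    [u = 1] and [u = -1]. It is obtained in three stages.
    - If [u] is a real scalar, divide by its absolute value ([gap_scalar]).
    - If [u] is simple, multiply by each idempotent of the partition: the inequality is local, and on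
      each block [u] is a real scalar ([gap_simple]).
    - In general, replacing [u] by a simple [s] costs at most [|s - u| c] with [c] independent of
      [s]. Simple elements are dense in U and the action on V is continuous, so that the error
      tends to 0 and, the distance of V being monotone, disappears ([gap_ge0]).

    Extensions are handled as submodules of M x V on which the second component is at most [p] of
    the first. Such a submodule is the graph of a map ([dominated_graph_fun]), so that the same
    inequality makes the extension well defined when [u x] is already in the domain. *)

Set Implicit Arguments.
Unset Strict Implicit.
Unset Printing Implicit Defensive.

Import Order.TTheory GRing.Theory Num.Theory.
Local Open Scope classical_set_scope.
Local Open Scope ring_scope.

(** * Riesz spaces *)

Section RieszTheory.
Context (R : realType) (U : rieszType R).
Implicit Types u v w : U.

Lemma rsub_ge0 u v : (0 ≼ v - u) = (u ≼ v).
Proof.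
apply/idP/idP => [/(rleD2r 0 (v - u) u)|/(rleD2r u v (- u))].
  by rewrite add0r subrK.
by rewrite subrr.
Qed.

Lemma raddr_ge0 u v : 0 ≼ u -> 0 ≼ v -> 0 ≼ u + v.
Proof.
move=> u0 v0; apply: rle_trans v0 _.
by rewrite -rsub_ge0 addrK.
Qed.

Lemma rle_join u v : u ≼ rjoin u v.
Proof.
by have := rle_refl (rjoin u v); rewrite rjoin_le => /andP[].
Qed.

Lemma rle_joinr u v : v ≼ rjoin u v.
Proof.
by have := rle_refl (rjoin u v); rewrite rjoin_le => /andP[].
Qed.

(** Both [rabs u - u] and [rabs u + u] are nonnegative, and their sum is twice [rabs u]. *)
Lemma rabs_ge0 u : 0 ≼ rabs u.
Proof.
have h : 0 ≼ rabs u + rabs u.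
  have : 0 ≼ (rabs u - u) + (rabs u - - u).
    by apply: raddr_ge0; rewrite rsub_ge0 ?rle_join ?rle_joinr.
  by rewrite opprK addrACA addNr addr0.
have -> : rabs u = 2^-1 *: (rabs u + rabs u).
  by rewrite -mulr2n -(scaler_nat _ (rabs u)) scalerA mulVf ?scale1r ?pnatr_eq0.
by apply: rscale_ge0 => //; rewrite invr_ge0.
Qed.

Lemma rabs_id u : 0 ≼ u -> rabs u = u.
Proof.
move=> u0; apply: rle_anti; rewrite rle_join rjoin_le rle_refl /= andbT.
by rewrite -rsub_ge0 opprK raddr_ge0.
Qed.

(** Any lower bound of the positive and the negative part can be subtracted from the positive
    part, which is the least upper bound of [u] and [0]. *)
Lemma rmeet_posneg u : rmeet (rjoin u 0) (rjoin u 0 - u) = 0.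
Proof.
set a := rjoin u 0; set m := rmeet _ _.
have : m ≼ m by exact: rle_refl.
rewrite {2}/m rle_meet => /andP[ma mu].
apply: rle_anti; rewrite {2}/m rle_meet rsub_ge0 rle_joinr rle_join !andbT.
have : a ≼ a - m.
  rewrite {1}/a rjoin_le rsub_ge0 ma andbT.
  by move: mu; rewrite -rsub_ge0 addrAC rsub_ge0.
by rewrite -rsub_ge0 addrAC subrr rsub_ge0.
Qed.

End RieszTheory.

(** The order is determined by the meet, which an embedding preserves. *)
Lemma embedding_ge0 (R : realType) (U W : rieszType R) (i : U -> W) :
  riesz_embedding i -> forall u, (0 ≼ i u) = (0 ≼ u).
Proof.
move=> [I L _ M] u.
have i0 : i 0 = 0.
  have := L 1 0 0; rewrite !scale1r addr0 => /esym/eqP.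
  by rewrite -subr_eq0 addrK => /eqP.
have meetE (X : rieszType R) (x : X) : (0 ≼ x) = (rmeet 0 x == 0).
  exact/esym/(@eq_meetl _ (ordered X) 0 x).
by rewrite !meetE -(inj_eq I) M i0.
Qed.

(** * Idempotents and simple elements of an f-algebra *)

Section FAlgebraTheory.
Context (R : realType) (U : fAlgType R).
Implicit Types u v e : U.

(** Multiplying by [v] and then by [u] keeps disjointness and ends with [u * v] disjoint from
    itself. *)
Lemma disjoint_mul0 u v : rmeet u v = 0 -> u * v = 0.
Proof.
move=> uv0; have : 0 ≼ rmeet u v by rewrite uv0 rle_refl.
rewrite rle_meet => /andP[u0 v0].
have uvv := falg_meet_mul _ _ _ uv0 v0.
have vuv : rmeet v (u * v) = 0 by rewrite -uvv; exact: (@meetC _ (ordered U)).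
have := falg_meet_mul _ _ _ vuv u0; rewrite (mulrC v u) => <-.
exact/esym/(@meetxx _ (ordered U)).
Qed.

(** The positive and the negative part of [u] have product 0, so that [u ^+ 2] is the sum of their
    squares. *)
Lemma rsqr_ge0 u : 0 ≼ u ^+ 2.
Proof.
have /disjoint_mul0 := rmeet_posneg u.
set a := rjoin u 0; set b := a - u => ab0.
have -> : u ^+ 2 = a * a + b * b.
  have -> : u = a - b by rewrite /b; ring.
  have -> : (a - b) ^+ 2 = a * a + b * b - 2%:R * (a * b) by ring.
  by rewrite ab0 mulr0 subr0.
have a0 : 0 ≼ a by exact: rle_joinr.
have b0 : 0 ≼ b by rewrite rsub_ge0 rle_join.
by apply: raddr_ge0; apply: falg_mul_ge0.
Qed.

Lemma idem_ge0 e : idem e -> 0 ≼ e.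
Proof. by move=> <-; exact: rsqr_ge0. Qed.

Lemma rone_ge0 : 0 ≼ (1 : U).
Proof. by rewrite -(expr1n _ 2); exact: rsqr_ge0. Qed.

Lemma finite_partition_orth n (e : 'I_n -> U) : finite_partition 1 e ->
  forall i j, i != j -> e i * e j = 0.
Proof.
move=> [eI eD _] i j /eD; rewrite !rabs_id; first exact: disjoint_mul0.
- exact/idem_ge0/eI.
- exact/idem_ge0/eI.
Qed.

(** On each block of the partition a simple element is a real scalar. *)
Lemma finite_partition_mul n (e : 'I_n -> U) (a : 'I_n -> R) i :
  finite_partition 1 e -> e i * (\sum_(j < n) a j *: e j) = e i * (a i)%:A.
Proof.
move=> eP; rewrite mulr_sumr (bigD1 i)//= big1 => [|j ji]; last first.
  by rewrite -scalerAr (finite_partition_orth eP) ?scaler0 1?eq_sym.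
have [eI _ _] := eP.
by rewrite addr0 -!scalerAr mulr1 -expr2 eI.
Qed.

End FAlgebraTheory.

(** * The action of U on V *)

Lemma ball_rdist (R : realType) (W : distRieszType R) (x y : metrized W) (e : R) :
  ball x e y = (rdist x y < e).
Proof. by rewrite ballEmdist. Qed.

Section ActTheory.
Context (R : realType) (F : metricFStructure R).
Local Notation U := (fs_U F).
Local Notation V := (fs_V F).
Local Notation iU := (@fs_inU R F).
Local Notation iV := (@fs_inV R F).
Implicit Types (u a b : U) (v w : V).

Lemma inV_inj : injective iV.
Proof. by case: (fs_inV_embedding F). Qed.

Lemma inVD v w : iV (v + w) = iV v + iV w.
Proof. by case: (fs_inV_embedding F) => _ L _ _; have := L 1 v w; rewrite !scale1r. Qed.

Lemma inV0 : iV 0 = 0.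
Proof. by apply: (addIr (iV 0)); rewrite -inVD !add0r. Qed.

Lemma inVN v : iV (- v) = - iV v.
Proof. by apply/eqP; rewrite -addr_eq0 -inVD addNr inV0. Qed.

Lemma inUD a b : iU (a + b) = iU a + iU b.
Proof.
by case: (fs_inU_embedding F) => -[_ L _ _] _ _; have := L 1 a b; rewrite !scale1r.
Qed.

Lemma inU0 : iU 0 = 0.
Proof. by apply: (addIr (iU 0)); rewrite -inUD !add0r. Qed.

Lemma inUN a : iU (- a) = - iU a.
Proof. by apply/eqP; rewrite -addr_eq0 -inUD addNr inU0. Qed.

Lemma inU1 : iU 1 = 1.
Proof. by case: (fs_inU_embedding F). Qed.

Lemma inUM a b : iU (a * b) = iU a * iU b.
Proof. by case: (fs_inU_embedding F). Qed.

(** Together with [inV_inj], reduces identities in V to identities in the ambient algebra, a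
    commutative ring. *)
Definition inE := (inVD, inVN, inV0, inUD, inUN, inU0, inU1, inUM, fs_actE).

Lemma inV_ge0 v : (0 ≼ iV v) = (0 ≼ v).
Proof. exact: embedding_ge0 (fs_inV_embedding F) _. Qed.

Lemma inU_ge0 a : (0 ≼ iU a) = (0 ≼ a).
Proof. by case: (fs_inU_embedding F) => H _ _; exact: embedding_ge0. Qed.

Lemma act0 v : fs_act (0 : U) v = 0.
Proof. by apply: inV_inj; rewrite !inE mul0r. Qed.

Lemma act1 v : fs_act (1 : U) v = v.
Proof. by apply: inV_inj; rewrite !inE mul1r. Qed.

Lemma actN1 v : fs_act (- 1 : U) v = - v.
Proof. by apply: inV_inj; rewrite !inE mulN1r. Qed.

Lemma act_unitK a b v : a * b = 1 -> fs_act a (fs_act b v) = v.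
Proof. by move=> ab; apply: inV_inj; rewrite !inE mulrA -inUM ab inE mul1r. Qed.

Lemma act_ge0 a v : 0 ≼ a -> 0 ≼ v -> 0 ≼ fs_act a v.
Proof.
by move=> a0 v0; rewrite -inV_ge0 inE falg_mul_ge0 ?inV_ge0 ?inU_ge0.
Qed.

Lemma act_sum_partition n (e : 'I_n -> U) v : \sum_(i < n) e i = 1 ->
  \sum_(i < n) fs_act (e i) v = v.
Proof.
move=> e1; apply: inV_inj.
rewrite (big_morph _ inVD inV0) (eq_bigr (fun i => iU (e i) * iV v)); last first.
  by move=> i _; rewrite inE.
by rewrite -mulr_suml -(big_morph _ inUD inU0) e1 inU1 mul1r.
Qed.

Lemma act_small v (eps : R) : 0 < eps ->
  exists2 delta : R, 0 < delta &
    forall a, rdist a 0 < delta -> rdist (fs_act a v) 0 < eps.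
Proof.
move=> eps0.
have /cvg_ballP/(_ _ eps0) := @fs_act_continuous R F (0, v).
move=> [[A B] /= [nA nB] AB].
have [delta /= delta0 dA] := (nbhs_ballP _ _).1 nA.
exists delta => // a ad.
have : A a by apply: dA; rewrite ball_rdist rdist_sym.
move=> Aa; have /= := AB (a, v) (conj Aa (nbhs_singleton nB)).
by rewrite act0 ball_rdist rdist_sym.
Qed.

Lemma simple_approx u (delta : R) : 0 < delta ->
  exists2 s, simple U s & rdist (s - u) 0 < delta.
Proof.
move=> delta0.
have [||s [/interior_subset us sS]] :=
    @mfalg_dense_simple R U (ball (u : metrized U) delta)^°.
- by exists u; exact: nbhsx_ballx.
- exact: open_interior.
exists s => //; rewrite -(mriesz_dist_transl _ _ u) subrK add0r rdist_sym.
by move: us; rewrite ball_rdist.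
Qed.

(** An archimedean principle: the positive part of [v] also lies below [rabs a] acting on [w], whose
    distance to 0 is arbitrarily small. *)
Lemma le0_of_act_small v w : 0 ≼ w ->
  (forall delta : R, 0 < delta ->
     exists2 a, rdist a 0 < delta & v ≼ fs_act (rabs a) w) ->
  v ≼ 0.
Proof.
move=> w0 H; have d0 : 0 <= rdist (rjoin v 0) 0 by exact: (@mdist_ge0 _ (metrized V)).
suff /rdist_positivity <- : rdist (rjoin v 0) 0 = 0 by exact: rle_join.
apply/eqP; move: d0; rewrite le_eqVlt eq_sym => /orP[//|/act_small-/(_ w)[delta delta0 dw]].
have [a ad va] := H _ delta0.
have := dw (rabs a); rewrite -mriesz_dist_abs => /(_ ad).
rewrite ltNge mriesz_dist_mono ?rle_joinr// rjoin_le va /=.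
by rewrite act_ge0 ?rabs_ge0.
Qed.

End ActTheory.

(** * The domination inequality along the multiples of a point *)

Section Extension.
Context (R : realType) (F : metricFStructure R) (M : vNormedModType F).
Local Notation U := (fs_U F).
Local Notation V := (fs_V F).
Context (p : M -> V) (p_sub : U_sublinear p).
Implicit Types (G : set (M * V)) (x y : M) (v w : V) (u s : U).

Lemma sublin0 : p 0 = 0.
Proof.
have [_ _ pZ] := p_sub.
by rewrite -[X in p X](scale0r 0) pZ ?rle_refl// act0.
Qed.

(** The room left in the inequality [v + u w ≼ p (y + u x)], which says that the value [w] at [x]
    keeps the extension below [p] on the translates of [y], of value [v], by multiples of [x]. *)
Definition gap x w y v u := p (y + u *: x) - v - fs_act u w.

(** Up to the factor [e], the gap depends on [u] only through [e * u]: this makes it local. *)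
Lemma act_gap x w y v e u : 0 ≼ e ->
  fs_act e (gap x w y v u) =
  p (e *: y + (e * u) *: x) - fs_act e v - fs_act (e * u) w.
Proof.
have [_ _ pZ] := p_sub => e0.
rewrite -scalerA -scalerDr pZ// /gap.
by apply: inV_inj; rewrite !inE; ring.
Qed.

Section Gap.
Context x w y v.
Hypothesis gap_base : v ≼ p y.
(* The choice of [w] provides these at every point of the domain; its points [b *: y] are those
   that [gap_scalar] and [gap_ge0] reach from [y]. *)
Hypothesis gap_pos : forall b : U, 0 ≼ b -> 0 ≼ gap x w (b *: y) (fs_act b v) 1.
Hypothesis gap_neg : forall b : U, 0 ≼ b -> 0 ≼ gap x w (b *: y) (fs_act b v) (- 1).

Lemma gap_scalar (r : R) : 0 ≼ gap x w y v r%:A.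
Proof.
have alg_ge0 (t : R) : 0 <= t -> 0 ≼ (t%:A : U).
  by move=> t0; apply: rscale_ge0 t0 _; exact: rone_ge0.
(* Dividing by a scalar |r| > 0 reduces to r = 1 or r = -1, at another point of the graph. *)
have scale (t : R) (e : U) : 0 < t ->
    (forall b, 0 ≼ b -> 0 ≼ gap x w (b *: y) (fs_act b v) e) ->
    0 ≼ gap x w y v (t%:A * e).
  move=> t0 /(_ (t^-1)%:A)/=; rewrite alg_ge0 ?invr_ge0 ?ltW// => /(_ isT).
  have tV : t%:A * (t^-1)%:A = 1 :> U.
    by rewrite -scalerAl mul1r scalerA mulfV ?scale1r ?gt_eqF.
  move=> /(act_ge0 (alg_ge0 _ (ltW t0))).
  by rewrite act_gap ?alg_ge0 ?ltW// scalerA tV scale1r act_unitK.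
have [r0|r0|->] := ltgtP r 0.
- have := scale (- r) (- 1); rewrite oppr_gt0 mulrN1 scaleNr opprK; exact.
- have := scale r 1; rewrite mulr1; exact.
- by rewrite scale0r /gap scale0r addr0 act0 subr0 rsub_ge0.
Qed.

(** Locality of the gap: on the [i]-th block of the partition [s] coincides with a real scalar. *)
Lemma gap_simple s : simple U s -> 0 ≼ gap x w y v s.
Proof.
move=> [n [a [e [eP ->]]]]; have [eI _ e1] := eP.
rewrite -(act_sum_partition (gap _ _ _ _ _) e1).
elim/big_ind : _ => [|? ? ? ?|i _]; [exact: rle_refl|exact: raddr_ge0|].
have e0 : 0 ≼ e i by exact/idem_ge0/eI.
rewrite act_gap// finite_partition_mul// -act_gap//.
by apply: act_ge0 => //; exact: gap_scalar.
Qed.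

(** For a simple [s] the negative of the gap at [u] exceeds that at [s] by at most [|s - u| c] with
    [c] independent of [s]; simple elements being dense, this error can be made arbitrarily
    small. *)
Lemma gap_ge0 u : 0 ≼ gap x w y v u.
Proof.
have [_ pD pZ] := p_sub.
have wpos : 0 ≼ p x - w.
  have := gap_pos (rle_refl 0).
  by rewrite /gap scale0r add0r scale1r act0 subr0 act1.
have wneg : 0 ≼ p (- x) + w.
  have := gap_neg (rle_refl 0); rewrite /gap scale0r add0r scaleN1r act0 subr0.
  by rewrite actN1 opprK.
pose c := (p x - w) + ((p (- x) + w) + (p (- x) + w)).
have c0 : 0 ≼ c by apply: raddr_ge0 => //; exact: raddr_ge0.
suff : - gap x w y v u ≼ 0 by rewrite -rsub_ge0 opprK add0r.
apply: (le0_of_act_small c0) => delta /(simple_approx u)[s sS su].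
exists (s - u) => //; rewrite -rsub_ge0 opprK.
set d := s - u; set D := rabs d.
have Dd : 0 ≼ D - d by rewrite rsub_ge0 rle_join.
have DNd : 0 ≼ D + d by rewrite -[d in D + d]opprK rsub_ge0 rle_joinr.
(* p (d x) - d w is bounded by writing d x = D x + (D - d) (- x) with nonnegative coefficients;
   the constant c doubles the second term because D - d is at most 2 D. *)
have -> : fs_act D c + gap x w y v u =
    gap x w y v s + fs_act (D + d) (p (- x) + w) +
    (p (y + u *: x) + (fs_act D (p x) + fs_act (D - d) (p (- x))) - p (y + s *: x)).
  by apply: inV_inj; rewrite /gap /c /d !inE; ring.
apply: raddr_ge0.
  by apply: raddr_ge0; [exact: gap_simple|exact: act_ge0].
rewrite rsub_ge0 -!pZ ?rabs_ge0//.
have -> : y + s *: x = (y + u *: x) + (D *: x + (D - d) *: (- x)).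
  rewrite scalerN -scalerBl -addrA -scalerDl; congr (_ + _ *: _).
  by rewrite /d; ring.
apply: rle_trans (pD _ _) _; rewrite ![p (y + u *: x) + _]addrC.
exact/rleD2r/pD.
Qed.

End Gap.

(** * Dominated graphs and maximal extensions *)

(** Partially defined maps are encoded by their graphs, so that extension is inclusion. That such
    a graph is functional is a consequence of domination, see [dominated_graph_fun]. *)
Definition dominated_graph G :=
  (forall u a b, G a -> G b -> G (u *: a.1 + b.1, fs_act u a.2 + b.2)) /\
  (forall a, G a -> a.2 ≼ p a.1).

Lemma dominated_graph0 G : dominated_graph G -> G !=set0 -> G (0, 0).
Proof.
move=> [GL _] [a Ga]; have := GL (- 1) _ _ Ga Ga.
by rewrite scaleN1r actN1 !addNr.
Qed.

(** The difference [t] of two values at the same point is a value at 0, so that both [t] and [- t]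
    are at most [p 0 = 0]. *)
Lemma dominated_graph_fun G y v w : dominated_graph G ->
  G (y, v) -> G (y, w) -> v = w.
Proof.
move=> GD; have [GL Gp] := GD.
have le t1 t2 : G (y, t1) -> G (y, t2) -> t1 ≼ t2.
  move=> G1 G2; have /Gp/= := GL (- 1) _ _ G2 G1.
  rewrite scaleN1r actN1 addNr sublin0 -rsub_ge0 sub0r -[t1 ≼ t2]rsub_ge0.
  by rewrite opprD opprK.
by move=> G1 G2; apply: rle_anti; rewrite !le.
Qed.

(** The lower bounds [a.2 - p (a.1 - x)] lie below the upper bounds [p (b.1 + x) - b.2] because
    [a.2 + b.2 ≼ p (a.1 + b.1)] and [a.1 + b.1 = (a.1 - x) + (b.1 + x)]; the supremum of the
    former separates the two families. *)
Lemma separating_value G x : dedekind_complete (ordered V) ->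
  dominated_graph G -> G !=set0 ->
  exists w, forall a, G a ->
    a.2 + w ≼ p (a.1 + x) /\ a.2 - w ≼ p (a.1 - x).
Proof.
move=> [Vsup _] [GL Gp] [a0 Ga0]; have [_ pD _] := p_sub.
pose S : set (ordered V) := [set a.2 - p (a.1 - x) | a in G].
have S0 : S !=set0 by exists (a0.2 - p (a0.1 - x)); exists a0.
have Sub b : G b -> ubound S (p (b.1 + x) - b.2).
  move=> Gb _ [a Ga <-]; rewrite /Order.le/= -rsub_ge0.
  have /Gp/= := GL 1 _ _ Ga Gb; rewrite act1 scale1r => ab.
  have -> : p (b.1 + x) - b.2 - (a.2 - p (a.1 - x)) =
      (p (a.1 - x) + p (b.1 + x) - p (a.1 + b.1)) + (p (a.1 + b.1) - (a.2 + b.2)).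
    by apply: inV_inj; rewrite !inE; ring.
  apply: raddr_ge0; rewrite rsub_ge0//.
  by apply: rle_trans (pD _ _); rewrite addrACA addNr addr0 rle_refl.
have [w [wub wlub]] := Vsup S S0 (ex_intro _ _ (Sub _ Ga0)).
exists w => a Ga; split.
  have : w ≼ p (a.1 + x) - a.2 := wlub _ (Sub _ Ga).
  by rewrite -rsub_ge0 -[_ ≼ p _]rsub_ge0 opprD addrA.
have : a.2 - p (a.1 - x) ≼ w by apply: wub; exists a.
rewrite -rsub_ge0 -[_ ≼ p _]rsub_ge0 !opprB.
by rewrite addrCA.
Qed.

(** Adjoins the multiples of [x], with a separating value at [x]. Domination makes the enlarged graph
    functional even where some [u *: x] already lies in the domain. *)
Lemma extend_dominated G x : dedekind_complete (ordered V) ->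
  dominated_graph G -> G !=set0 ->
  exists G', [/\ dominated_graph G', G `<=` G' & exists w, G' (x, w)].
Proof.
move=> Vcompl GD Gne; have [GL Gp] := GD.
have [w wP] := separating_value x Vcompl GD Gne.
have G0 := dominated_graph0 GD Gne.
have GZ u a : G a -> G (u *: a.1, fs_act u a.2).
  by move=> Ga; have := GL u _ _ Ga G0; rewrite /= !addr0.
exists [set z | exists a u, G a /\ z = (a.1 + u *: x, a.2 + fs_act u w)]; split.
- split=> [t _ _ [a [u [Ga ->]]] [b [s [Gb ->]]]|_ [a [u [Ga ->]]]] /=.
    exists (t *: a.1 + b.1, fs_act t a.2 + b.2), (t * u + s); split; first exact: GL.
    congr (_, _) => /=; first by rewrite scalerDr scalerA scalerDl addrACA.
    by apply: inV_inj; rewrite !inE; ring.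
  rewrite -rsub_ge0 opprD addrA.
  apply: gap_ge0 => [|b _|b _]; first exact: Gp.
    by rewrite /gap act1 scale1r -addrA -opprD rsub_ge0; have [] := wP _ (GZ b _ Ga).
  rewrite /gap scaleN1r actN1 -addrA -opprD rsub_ge0.
  by have [] := wP _ (GZ b _ Ga).
- move=> a Ga; exists a, 0; split => //.
  by rewrite scale0r act0 !addr0; case: a {Ga}.
- exists w, (0, 0), 1; split => //=.
  by rewrite scale1r act1 !add0r.
Qed.

(** Zorn's lemma. The empty graph is admitted among the candidates because an empty chain has the
    empty set as its union; a maximal candidate cannot be empty since [G] is larger. *)
Lemma total_dominated_graph G : dedekind_complete (ordered V) ->
  dominated_graph G -> G !=set0 ->
  exists H, [/\ dominated_graph H, G `<=` H & forall x, exists w, H (x, w)].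
Proof.
move=> Vcompl GD Gne.
pose Q H := dominated_graph H /\ (H !=set0 -> G `<=` H).
have [C CQ Ctot|H [[HD GH] Hmax]] := @Zorn_bigcup _ Q.
  split.
    split=> [u a b [A CA Aa] [B CB Bb]|a [A CA Aa]]; last first.
      by have [[_ Ap] _] := CQ _ CA; exact: Ap.
    have [AB|BA] := Ctot _ _ CA CB.
      exists B => //; have [[BL _] _] := CQ _ CB.
      by apply: BL => //; exact: AB.
    exists A => //; have [[AL _] _] := CQ _ CA.
    by apply: AL => //; exact: BA.
  move=> [a [A CA Aa]] b Gb; exists A => //.
  by have [_ GA] := CQ _ CA; apply: GA => //; exists a.
have Hne : H !=set0.
  apply/set0P/eqP => H0; apply: (Hmax G).
    by rewrite H0; split=> [? []//|G0]; case: Gne => a /G0.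
  by split=> // _; exact: subset_refl.
exists H; split => // [|x]; first exact: GH.
have [H' [H'D HH' [w H'w]]] := extend_dominated x Vcompl HD Hne.
exists w; apply: contrapT => Hw; apply: (Hmax H').
  by split => // H'H; apply/Hw/H'H.
by split => // _; apply: subset_trans HH'; exact: GH.
Qed.

End Extension.

Unset Implicit Arguments.

Theorem theorem3p30 (R : realType) (F : metricFStructure R) (F_CR : fs_CR F)
    (M : vNormedModType F) (P : pred M) (N : subLmodType P)
    (N_glueing : glueings [set` P] = [set` P])
    (N_proper : [set` P] `<` [set: M])
    (f : {linear N -> fs_V F | @fs_act R F})
    (p : M -> fs_V F) (p_sublinear : U_sublinear p)
    (f_le_p : forall x : N, f x ≼ p (val x)) :
  exists g : {linear M -> fs_V F | @fs_act R F},
    (forall x : N, g (val x) = f x) /\ (forall x : M, g x ≼ p x).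
Proof.
have [_ _ Vcompl] := F_CR.
pose G := [set (val x, f x) | x in [set: N]].
have GD : dominated_graph p G.
  split=> [u _ _ [x _ <-] [y _ <-]|_ [x _ <-]] /=; last exact: f_le_p.
  by exists (u *: x + y) => //; rewrite linearP linearP.
have [H [HD GH Htot]] : exists H, [/\ dominated_graph p H, G `<=` H &
    forall x, exists w, H (x, w)].
  apply: total_dominated_graph => //; first by case: Vcompl.
  by exists (val (0 : N), f 0); exists 0.
have [g gP] := choice Htot.
have gE x w : H (x, w) -> g x = w := dominated_graph_fun p_sublinear HD (gP x).
have gL : GRing.linear_for (@fs_act R F) g.
  by move=> u x y; apply: gE; case: HD => HL _; exact: HL u _ _ (gP x) (gP y).
have gD : nmod_morphism g.
  split=> [|x y].
    apply: gE; apply: (dominated_graph0 HD); exists (0, g 0); exact: gP.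
  by have := gL 1 x y; rewrite act1 scale1r.
have gZ : GRing.scalable_for (@fs_act R F) g.
  by move=> u x; have := gL u x 0; rewrite gD.1 !addr0.
pose gl : {linear M -> fs_V F | @fs_act R F} :=
  HB.pack g (GRing.isNmodMorphism.Build _ _ g gD)
    (GRing.isScalable.Build _ _ _ _ g gZ).
exists gl; split=> x /=; first by apply: gE; apply: GH; exists x.
by case: HD => _ Hp; exact: Hp _ (gP x).
Qed.
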